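(* Let the problem $(\mathcal{P})$: minimize $f(x)$ subject to $x \in M$, $x \in Q$, be Levitin-Polyak well-posed with respect to the infeasibility measure $\varphi$. Then the penalty function $F_c = f + c\varphi$ is globally exact if and only if the following three conditions hold true: 1. $F_c$ has the zero duality gap property, i.e. $\sup_{c \ge 0} \inf_{x \in Q} F_c(x) = f_*$; 2. there exists $c_0 \ge 0$ such that $F_c$ attains a global minimum on $Q$ for any $c \ge c_0$; 3. $F_c$ is locally exact at every globally optimal solution of the problem $(\mathcal{P})$.
   Context: $(X,d)$ is a metric space, $M,Q \subset X$ are nonempty, $f \colon X \to \mathbb{R}\cup\{+\infty\}$. The feasible region $\Omega = M \cap Q$ is nonempty and the optimal value $f_* = \inf_{x\in\Omega} f(x)$ is finite; $\operatorname{argmin}(\mathcal{P})$ is the set of globally optimal solutions of $(\mathcal{P})$. An infeasibility measure (penalty term) for the constraint $x \in M$ on $Q$ is a function $\varphi \colon X \to [0,+\infty]$ such that for any $x \in Q$ one has $\varphi(x)=0 \iff x \in M$; such a $\varphi$ is fixed, and $F_c(x) = f(x) + c\varphi(x)$, $x\in X$, $c \ge 0$. The penalized problem is: minimize $F_c(x)$ subject to $x \in Q$. $(\mathcal{P})$ is Levitin-Polyak well-posed with respect to $\varphi$ if $\operatorname{argmin}(\mathcal{P}) \neq \emptyset$ and for any sequence $\{x_n\}\subset X$ such that $f(x_n)\to f_*$ and $\varphi(x_n)\to 0$ there exists a subsequence converging to some $x_* \in \operatorname{argmin}(\mathcal{P})$. $F_c$ is globally exact if there exists $c_* \ge 0$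 such that for any $c \ge c_*$ the sets of globally optimal solutions of $(\mathcal{P})$ and of the penalized problem coincide. $F_c$ is locally exact at a locally optimal solution $x_*$ of $(\mathcal{P})$ if there exists $c_* \ge 0$ such that for any $c\ge c_*$ the point $x_*$ is a locally optimal solution of the penalized problem. *)

(* Defs.v *)
From mathcomp Require Import all_boot all_order all_algebra.
From mathcomp Require Import all_classical all_reals all_analysis.

Set Implicit Arguments.
Unset Strict Implicit.
Unset Printing Implicit Defensive.

Import Order.TTheory GRing.Theory Num.Theory.

Local Open Scope classical_set_scope.
Local Open Scope ring_scope.
Local Open Scope ereal_scope.

(* An optimization problem "minimize g over A" is given by g : X -> \bar R and
   A : set X. The problem (P) is (f, M `&` Q); the penalized problem with
   parameter c is (penalty f phi c, Q). *)

Definition optimal_value (R : realType) (X : Type) (g : X -> \bar R)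
    (A : set X) : \bar R :=
  ereal_inf [set g x | x in A].

Definition global_solutions (R : realType) (X : Type) (g : X -> \bar R)
    (A : set X) : set X :=
  [set x | A x /\ forall y, A y -> g x <= g y].

Definition local_solutions (R : realType) (X : metricType R)
    (g : X -> \bar R) (A : set X) : set X :=
  [set x | A x /\ \forall y \near x, A y -> g x <= g y].

Definition infeasibility_measure (R : realType) (X : Type) (M Q : set X)
    (phi : X -> \bar R) : Prop :=
  (forall x, 0 <= phi x) /\ (forall x, Q x -> (phi x = 0 <-> M x)).

(* For c = 0 the convention is 0 * +oo = 0, so that penalty f phi 0 = f. *)
Definition penalty (R : realType) (X : Type) (f phi : X -> \bar R) (c : R)
    (x : X) : \bar R :=
  f x + c%:E * phi x.

(* The sequence x ranges over X, it is not required to lie in Q. *)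
Definition Levitin_Polyak_well_posed (R : realType) (X : metricType R)
    (f phi : X -> \bar R) (M Q : set X) : Prop :=
  global_solutions f (M `&` Q) !=set0 /\
  forall x : nat -> X,
    f (x n) @[n --> \oo] --> optimal_value f (M `&` Q) ->
    phi (x n) @[n --> \oo] --> (0 : \bar R) ->
    exists k : nat -> nat, {homo k : m n / (m < n)%N} /\
      exists2 xs : X, global_solutions f (M `&` Q) xs &
        x (k n) @[n --> \oo] --> xs.

Definition globally_exact (R : realType) (X : Type) (f phi : X -> \bar R)
    (M Q : set X) : Prop :=
  exists cs : R, (0 <= cs)%R /\ forall c : R, (cs <= c)%R ->
    global_solutions f (M `&` Q) = global_solutions (penalty f phi c) Q.

(* Only meant for xs in local_solutions f (M `&` Q), which contains
   global_solutions f (M `&` Q). *)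
Definition locally_exact_at (R : realType) (X : metricType R)
    (f phi : X -> \bar R) (Q : set X) (xs : X) : Prop :=
  exists cs : R, (0 <= cs)%R /\ forall c : R, (cs <= c)%R ->
    local_solutions (penalty f phi c) Q xs.

Definition zero_duality_gap (R : realType) (X : Type) (f phi : X -> \bar R)
    (M Q : set X) : Prop :=
  ereal_sup [set optimal_value (penalty f phi c) Q | c in [set c : R | (0 <= c)%R]]
    = optimal_value f (M `&` Q).

(* Main.v *)
Require Import Defs.
From mathcomp Require Import all_boot all_order all_algebra.
From mathcomp Require Import all_classical all_reals all_analysis.
From mathcomp Require Import lra.

(** The real content is that some penalty parameter [c] satisfies
    [f_* <= F_c] on [Q]; any larger parameter is then exact, because a
    minimizer of [F_(c+1)] with positive [phi] would have [F_c < f_*].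
    If no such [c] exists, pick [x_n] in [Q] with [F_(n+1) (x_n) < f_*]. The
    zero duality gap gives, for each [e > 0], some [c] with
    [f_* - e <= F_c (x_n)] for all [n]; comparing both bounds forces
    [phi (x_n) --> 0] and then [f (x_n) --> f_*]. By well-posedness a
    subsequence converges to a solution, near which local exactness
    contradicts [F_(n+1) (x_n) < f_*]. *)

Set Implicit Arguments.
Unset Strict Implicit.
Unset Printing Implicit Defensive.

Import Order.TTheory GRing.Theory Num.Theory.
Import numFieldNormedType.Exports.

Local Open Scope classical_set_scope.
Local Open Scope ring_scope.

(** Meant for [a n] $= f(x_n)$ and [b n] $= \varphi(x_n)$. Subtracting the lower bound from the
    upper one leaves [(n.+1%:R - c) * b n < e] with [c] independent of [n], which squeezes [b] to 0;
    then the two bounds pinch [a]. *)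
Lemma penalty_values_cvg (R : realType) (a b : nat -> R) (r : R) :
  (forall n, 0 <= b n) ->
  (forall n, a n + n.+1%:R * b n < r) ->
  (forall e, 0 < e -> exists2 c, 0 <= c & forall n, r - e <= a n + c * b n) ->
  b n @[n --> \oo] --> 0 /\ a n @[n --> \oo] --> r.
Proof.
move=> b0 ub lb.
have b_cvg : b n @[n --> \oo] --> (0 : R).
  apply/cvgr0Pnorm_lt => e e0.
  have ei0 : 0 < e^-1 by rewrite invr_gt0.
  have [c c0 cb] := lb 1 ltr01.
  near=> n.
  (* This size of [n] makes [(n%:R + 1 - c) * e] at least 1, while the bounds for error 1 keep
     [(n%:R + 1 - c) * b n] below 1; so [b n] cannot reach [e]. *)
  have nc : c + e^-1 < n%:R by near: n; exact: nbhs_infty_gtr.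
  rewrite ger0_norm // ltNge; apply/negP => eb.
  have := ub n; have := cb n; rewrite -natr1 => h1 h2.
  have h3 : (n%:R + 1 - c) * b n < 1 by lra.
  have h4 : 1 <= (n%:R + 1 - c) * e.
    by rewrite -ler_pdivrMr // div1r; lra.
  have h5 : (n%:R + 1 - c) * e <= (n%:R + 1 - c) * b n.
    by apply: ler_wpM2l => //; lra.
  lra.
split => //; apply/cvgrPdist_lt => e e0.
have e20 : 0 < e / 2 by lra.
(* Half of [e] pays for the lower bound, half for [c * b n]. Dividing by [c + 1] avoids a zero
   divisor when [c] is 0. *)
have [c c0 cb] := lb _ e20.
have c10 : 0 < c + 1 by lra.
have d0 : 0 < e / 2 / (c + 1) by rewrite divr_gt0.
near=> n.
have bn : b n < e / 2 / (c + 1).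
  rewrite -[b n]ger0_norm //; near: n.
  by move/cvgr0Pnorm_lt: b_cvg; exact.
have cbn : (c + 1) * b n < e / 2 by rewrite mulrC -ltr_pdivlMr.
have nb : 0 <= n.+1%:R * b n by rewrite mulr_ge0.
have := ub n; have := cb n; have := b0 n => h1 h2 h3.
rewrite ger0_norm; lra.
Unshelve. all: by end_near. Qed.

Local Open Scope ereal_scope.

Lemma optimal_value_le (R : realType) (X : Type) (g : X -> \bar R) (A : set X)
    (x : X) :
  A x -> optimal_value g A <= g x.
Proof. by move=> Ax; apply: ereal_inf_lbound; exists x. Qed.

Lemma optimal_value_global_solution (R : realType) (X : Type)
    (g : X -> \bar R) (A : set X) (x : X) :
  global_solutions g A x -> optimal_value g A = g x.
Proof.
move=> [Ax xmin]; apply/eqP; rewrite eq_le optimal_value_le //=.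
by apply: le_ereal_inf_tmp => _ [y Ay <-]; exact: xmin.
Qed.

Lemma global_solution_of_le (R : realType) (X : Type) (g : X -> \bar R)
    (A : set X) (x : X) :
  A x -> g x <= optimal_value g A -> global_solutions g A x.
Proof.
move=> Ax gx; split => // y Ay.
by apply: (le_trans gx); exact: optimal_value_le.
Qed.

Section penalty_theory.
Context (R : realType) (X : Type) (M Q : set X) (f phi : X -> \bar R).
Hypothesis phi_measure : infeasibility_measure M Q phi.

Lemma penalty_feasible (c : R) (x : X) :
  (M `&` Q) x -> penalty f phi c x = f x.
Proof.
move=> [Mx Qx]; have /phi_measure.2 [_ /(_ Mx) p0] := Qx.
by rewrite /penalty p0 mule0 adde0.
Qed.

Lemma le_penalty (c d : R) (x : X) : (c <= d)%R ->
  penalty f phi c x <= penalty f phi d x.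
Proof.
by move=> cd; rewrite leeD2l // lee_wpmul2r ?lee_fin//; exact: phi_measure.1.
Qed.

Lemma optimal_value_penalty_le (c : R) :
  optimal_value (penalty f phi c) Q <= optimal_value f (M `&` Q).
Proof.
apply: le_ereal_inf_tmp => _ [y [My Qy] <-].
by rewrite -(penalty_feasible c (conj My Qy)) optimal_value_le.
Qed.

Hypothesis f_proper : forall x : X, f x != -oo.

(** Positivity of [c] matters: since [0 * +oo = 0], a finite $F_0(x)$ would not exclude an infinite
    [phi x]. *)
Lemma penalty_fin (c : R) (x : X) : (0 < c)%R -> penalty f phi c x < +oo ->
  exists ab : R * R,
    [/\ f x = ab.1%:E, phi x = ab.2%:E & (0 <= ab.2)%R].
Proof.
move=> c0; rewrite /penalty.
have := f_proper x; have := phi_measure.1 x.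
case: (f x) => [a| |] //; case: (phi x) => [b| |] //=.
- by rewrite lee_fin => b0 _ _; exists (a, b).
- by rewrite gt0_muley ?lte_fin// addey.
by rewrite gt0_muley ?lte_fin.
Qed.

Lemma penalty_bound_globally_exact (c : R) :
  optimal_value f (M `&` Q) \is a fin_num ->
  global_solutions f (M `&` Q) !=set0 ->
  (0 <= c)%R ->
  (forall y, Q y -> optimal_value f (M `&` Q) <= penalty f phi c y) ->
  globally_exact f phi M Q.
Proof.
move=> fs_fin [xs xs_sol] c0 cQ.
(* The shift by 1 makes every admissible [d] strictly larger than [c]; at [c] itself a minimizer may
   be infeasible. *)
exists (c + 1)%R; split; first lra.
move=> d cd; have ltcd : (c < d)%R by lra.
(* Once the optimal values agree, solving either problem means attaining $f_*$, so only feasibility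
   of the penalized minimizers remains. *)
have valE : optimal_value (penalty f phi d) Q = optimal_value f (M `&` Q).
  apply/eqP; rewrite eq_le optimal_value_penalty_le /=.
  apply: le_ereal_inf_tmp => _ [y Qy <-].
  by apply: (le_trans (cQ _ Qy)); apply: le_penalty; exact: ltW.
apply/seteqP; split => x.
  move=> xsol; have [[Mx Qx] _] := xsol.
  apply: global_solution_of_le => //.
  by rewrite penalty_feasible // valE (optimal_value_global_solution xsol).
move=> xsol; have [Qx _] := xsol.
have := optimal_value_global_solution xsol; rewrite valE => fsE.
have Fltoo : penalty f phi d x < +oo by rewrite -fsE ltey_eq fs_fin.
have [|[a b] /= [fa pb b0]] := penalty_fin _ Fltoo; first lra.
have := cQ _ Qx; rewrite fsE /penalty fa pb -!EFinM -!EFinD lee_fin => h.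
(* From $a + d b = f_* \le a + c b$. *)
have dcb : ((d - c) * b <= 0)%R by lra.
have bE : b = 0%R.
  apply/eqP; rewrite eq_le b0 andbT.
  by rewrite -(pmulr_rle0 _ (_ : 0 < d - c)%R) // subr_gt0.
have Mx : M x by apply/(phi_measure.2 _ Qx); rewrite pb bE.
apply: global_solution_of_le => //.
by rewrite fsE penalty_feasible.
Qed.

End penalty_theory.

Lemma exact_penalty_bound (R : realType) (X : metricType R) (M Q : set X)
    (f phi : X -> \bar R) :
  (forall x : X, f x != -oo) ->
  optimal_value f (M `&` Q) \is a fin_num ->
  infeasibility_measure M Q phi ->
  Levitin_Polyak_well_posed f phi M Q ->
  zero_duality_gap f phi M Q ->
  (forall xs : X, global_solutions f (M `&` Q) xs ->
     locally_exact_at f phi Q xs) ->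
  exists2 c : R, (0 <= c)%R &
    forall y, Q y -> optimal_value f (M `&` Q) <= penalty f phi c y.
Proof.
move=> f_proper fs_fin phiP [_ LP] gap loc.
apply: contrapT => nobound.
(* The parameter [n.+1] is never 0, so [penalty_fin] makes $f$ and $\varphi$ finite at every
   [x n]. *)
have /choice[x xP] : forall n : nat, exists y,
    Q y /\ penalty f phi n.+1%:R y < optimal_value f (M `&` Q).
  move=> n; apply: contrapT => noy; apply: nobound.
  exists n.+1%:R => // y Qy; rewrite leNgt; apply/negP => lty.
  by apply: noy; exists y.
have [r rE] : exists r, optimal_value f (M `&` Q) = r%:E.
  by exists (fine (optimal_value f (M `&` Q))); rewrite fineK.
have /choice[ab abP] n : exists ab : R * R,
    [/\ f (x n) = ab.1%:E, phi (x n) = ab.2%:E & (0 <= ab.2)%R].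
  apply: (penalty_fin phiP f_proper (c := n.+1%:R)) => //.
  by apply: lt_trans (xP n).2 _; rewrite ltey_eq fs_fin.
have FE c n : penalty f phi c (x n) = ((ab n).1 + c * (ab n).2)%:E.
  by have [fE pE _] := abP n; rewrite /penalty fE pE.
have [||e e0|b0 ar] := @penalty_values_cvg R (fst \o ab) (snd \o ab) r.
- by move=> n; have [] := abP n.
- by move=> n; rewrite -lte_fin -rE -FE; exact: (xP n).2.
(* As $f_* - e$ lies below the supremum of the penalized values, a single [c] serves all [n]. *)
- have : (r - e)%:E < ereal_sup [set optimal_value (penalty f phi c) Q |
      c in [set c : R | (0 <= c)%R]] by rewrite gap rE lte_fin; lra.
  move=> /ereal_sup_gt[_ [c /= c0 <-] lec].
  exists c => // n; rewrite -lee_fin -FE; apply: (le_trans (ltW lec)).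
  by apply: optimal_value_le; exact: (xP n).1.
have [||k [kincr [xs xs_sol kxs]]] := LP x.
- rewrite rE (_ : (fun n => f (x n)) = EFin \o (fst \o ab)).
    by apply: cvg_EFin => //; exact: nearW.
  by apply/funext => n /=; have [] := abP n.
- rewrite (_ : (fun n => phi (x n)) = EFin \o (snd \o ab)).
    by apply: cvg_EFin => //; exact: nearW.
  by apply/funext => n /=; have [] := abP n.
have [c [c0 /(_ c (lexx c)) [_ locmin]]] := loc _ xs_sol.
have kge n : (n <= k n)%N.
  by elim: n => // n /leq_ltn_trans; apply; exact: kincr.
(* Take [n] so large that [x (k n)] lies in the neighbourhood where [xs] minimizes $F_c$ and [n]
   exceeds [c]; by [kge] the parameter [(k n).+1] exceeds [c] too. *)
have [n [xn cn]] : exists n, (Q (x (k n)) ->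
    penalty f phi c xs <= penalty f phi c (x (k n))) /\ (c < n%:R)%R.
  near \oo => n; exists n; split; near: n; last exact: nbhs_infty_gtr.
  exact: (kxs _ locmin).
have [Qxn] := xP (k n); apply/negP; rewrite -leNgt.
have ck : (c <= (k n).+1%:R)%R.
  by rewrite (le_trans (ltW cn)) // ler_nat ltnW // ltnS.
apply: le_trans (le_penalty f phiP _ ck).
apply: le_trans (xn Qxn).
rewrite (penalty_feasible f phiP) ?(optimal_value_global_solution xs_sol)//.
exact: xs_sol.1.
Unshelve. all: by end_near. Qed.

Theorem corollary3 (R : realType) (X : metricType R) (M Q : set X)
    (f phi : X -> \bar R)
    (M_neq0 : M !=set0) (Q_neq0 : Q !=set0)
    (f_proper : forall x : X, f x != -oo)
    (feasible : (M `&` Q) !=set0)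
    (fstar_fin : optimal_value f (M `&` Q) \is a fin_num)
    (phi_measure : infeasibility_measure M Q phi)
    (well_posed : Levitin_Polyak_well_posed f phi M Q) :
  globally_exact f phi M Q <->
  [/\ zero_duality_gap f phi M Q,
      (exists c0 : R, (0 <= c0)%R /\ forall c : R, (c0 <= c)%R ->
         global_solutions (penalty f phi c) Q !=set0) &
      (forall xs : X, global_solutions f (M `&` Q) xs ->
         locally_exact_at f phi Q xs)].
Proof.
have [[xs xs_sol] _] := well_posed.
split=> [[cs [cs0 csE]]|[gap _ loc]]; last first.
  have [c c0 cQ] :=
    exact_penalty_bound f_proper fstar_fin phi_measure well_posed gap loc.
  apply: (penalty_bound_globally_exact phi_measure f_proper) cQ => //.
  by exists xs.
split.
- rewrite /zero_duality_gap; apply/eqP; rewrite eq_le; apply/andP; split.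
    by apply: ge_ereal_sup => _ [c _ <-]; exact: optimal_value_penalty_le.
  (* The supremum is attained at [cs]: there [xs] solves both problems, with common value $f_*$. *)
  apply: ereal_sup_ubound; exists cs => //.
  have xs_pen : global_solutions (penalty f phi cs) Q xs by rewrite -csE.
  rewrite (optimal_value_global_solution xs_pen).
  rewrite (optimal_value_global_solution xs_sol).
  by apply: (penalty_feasible f phi_measure); exact: xs_sol.1.
- by exists cs; split => // c /csE <-; exists xs.
- move=> y ysol; exists cs; split => // c /csE csc.
  have [Qy ymin] : global_solutions (penalty f phi c) Q y by rewrite -csc.
  by split => //; exact: nearW.
Qed.
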